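(* Let $\Phi,\Psi:M_m(\mathbb{C})\to M_n(\mathbb{C})$ be completely positive maps, and let $C_\Phi,C_\Psi\in M_m(\mathbb{C})\otimes M_n(\mathbb{C})$ be their Choi matrices. Then the Choi matrix of the geometric mean $\Phi\#\Psi$ is the (Kubo–Ando) geometric mean of $C_\Phi$ and $C_\Psi$: \[ C_{\Phi\#\Psi}=C_\Phi\#C_\Psi . \]
   Context: The Choi matrix of a linear map $\Phi:M_m(\mathbb{C})\to M_n(\mathbb{C})$ is $C_\Phi=\sum_{i,j=1}^m e_{ij}\otimes\Phi(e_{ij})$, with $e_{ij}$ the standard matrix units of $M_m(\mathbb{C})$. For positive semidefinite matrices $C,D$ of the same size, $C\#D$ denotes the Kubo–Ando geometric mean, i.e. the maximum (in the Loewner order) of all positive semidefinite $X$ with $\begin{bmatrix} C & X \\ {} X & D \end{bmatrix}\ge 0$. Geometric mean of CP maps (here $\mathcal{M}=M_m(\mathbb{C})$, $\mathcal{N}=M_n(\mathbb{C})$). For a complex vector space $\mathcal{V}$ and positive sesquilinear forms $\alpha,\beta$ on $\mathcal{V}$ (linear in the first variable), a compatible representation consists of a linear map $h$ from $\mathcal{V}$ onto a dense subspace of a Hilbert space $\mathcal{H}$ and commuting positive $A,B\in\mathbb{B}(\mathcal{H})$ with $\alpha(x,y)=\langle Ah(x),h(y)\rangle$, $\beta(x,y)=\langle Bh(x),h(y)\rangle$. By Pusz–Woronowicz such representations always exist and the form $(\alpha\#\beta)(x,y):=\langle\sqrt{AB}\,h(x),h(y)\rangle$ does not depend on the choice. Let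 $L^2(\mathcal{N})$ be the standard form Hilbert space of $\mathcal{N}$ (here $M_n(\mathbb{C})$ with the inner product $\langle x,y\rangle=\mathrm{tr}(y^*x)$, $\mathrm{tr}$ the normalized trace, and left multiplication). For a CP map $\Phi:\mathcal{M}\to\mathcal{N}$, $s_\Phi$ is the positive sesquilinear form on $\mathcal{M}\odot L^2(\mathcal{N})$ (algebraic tensor product) given by $s_\Phi(x\otimes\xi,y\otimes\eta)=\langle\Phi(y^*x)\xi,\eta\rangle$. The geometric mean $\Phi\#\Psi$ is the unique CP map $\mathcal{M}\to\mathcal{N}$ with $\langle(\Phi\#\Psi)(y^*x)\xi,\eta\rangle=(s_\Phi\#s_\Psi)(x\otimes\xi,y\otimes\eta)$ for all $x,y\in\mathcal{M}$, $\xi,\eta\in L^2(\mathcal{N})$. *)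

(* Defs.v *)
(* The complex numbers are R[i] for R : realType. *)
From HB Require Import structures.
From mathcomp Require Import all_boot all_order all_algebra.
From mathcomp Require Import all_classical all_reals all_analysis.
From mathcomp Require Import complex mxtens.

Set Implicit Arguments.
Unset Strict Implicit.
Unset Printing Implicit Defensive.

Import Order.TTheory GRing.Theory Num.Theory.
Import numFieldNormedType.Exports.
Local Open Scope classical_set_scope.
Local Open Scope ring_scope.
Local Open Scope sesquilinear_scope.

Section Matrices.
Variable R : realType.
Local Notation C := R[i].

(* In the order of R[i], 0 <= z forces z to be real, so psdmx matrices are
   hermitian. *)
Definition psdmx (d : nat) (A : 'M[C]_d) : Prop :=
  forall v : 'cV[C]_d, 0 <= (v ^t* *m A *m v) 0 0.

Definition loewner_le (d : nat) (A B : 'M[C]_d) : Prop := psdmx (B - A).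

Definition is_psdmx_mean (d : nat) (A B X : 'M[C]_d) : Prop :=
  let admissible Y := psdmx Y /\ psdmx (block_mx A Y Y B) in
  admissible X /\ forall Y, admissible Y -> loewner_le Y X.

(* The maximum exists and is unique when A and B are positive semidefinite;
   the default value 0 is then irrelevant. *)
Definition psdmx_mean (d : nat) (A B : 'M[C]_d) : 'M[C]_d :=
  xget 0 (is_psdmx_mean A B).

(* With 'M_(k * d) read as 'M_k (x) 'M_d, u is the sum of the
   delta_mx i j *t tens_block u i j. *)
Definition tens_block (k d : nat) (u : 'M[C]_(k * d)) (i j : 'I_k) : 'M[C]_d :=
  \matrix_(a, b) u (mxtens_index (i, a)) (mxtens_index (j, b)).

(* id (x) Phi on 'M_k (x) 'M_m. *)
Definition ampliation (m n k : nat) (Phi : 'M[C]_m -> 'M[C]_n)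
    (u : 'M[C]_(k * m)) : 'M[C]_(k * n) :=
  \sum_(i < k) \sum_(j < k) delta_mx i j *t Phi (tens_block u i j).

Definition completely_positive (m n : nat) (Phi : 'M[C]_m -> 'M[C]_n) : Prop :=
  forall (k : nat) (u : 'M[C]_(k * m)), psdmx u -> psdmx (ampliation Phi u).

Definition choi (m n : nat) (Phi : 'M[C]_m -> 'M[C]_n) : 'M[C]_(m * n) :=
  \sum_(i < m) \sum_(j < m) delta_mx i j *t Phi (delta_mx i j).

(* Inner product of L^2(M_n), for the normalized trace of M_n. *)
Definition L2dot (n : nat) (x y : 'M[C]_n) : C := n%:R^-1 * \tr (y ^t* *m x).

End Matrices.

HB.mixin Record NormedModule_isHilbert (R : realType) H
    & CompleteNormedModule R[i] H := {
  hdot : {dot H for (@Num.conj R[i])} ;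
  hdot_norm : forall x : H, `|x| ^+ 2 = hdot x x
}.

#[short(type="hilbertType")]
HB.structure Definition Hilbert (R : realType) :=
  {H of NormedModule_isHilbert R H & CompleteNormedModule R[i] H}.

Section FormMean.
Variable R : realType.
Local Notation C := R[i].

Definition positive_op (H : hilbertType R) (T : {linear H -> H}) : Prop :=
  continuous T /\ forall x, 0 <= hdot (T x) x.

Record compatible_rep (V : lmodType C) (alpha beta : V -> V -> C) := {
  rep_space : hilbertType R ;
  rep_map : {linear V -> rep_space} ;
  rep_A : {linear rep_space -> rep_space} ;
  rep_B : {linear rep_space -> rep_space} ;
  rep_dense : dense (range rep_map) ;
  rep_A_pos : positive_op rep_A ;
  rep_B_pos : positive_op rep_B ;
  rep_comm : forall z, rep_A (rep_B z) = rep_B (rep_A z) ;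
  rep_alphaE : forall x y, alpha x y = hdot (rep_A (rep_map x)) (rep_map y) ;
  rep_betaE : forall x y, beta x y = hdot (rep_B (rep_map x)) (rep_map y)
}.

(* S is the square root of AB: its unique positive square root. *)
Definition is_form_mean (V : lmodType C) (alpha beta gamma : V -> V -> C)
    : Prop :=
  exists (r : compatible_rep alpha beta)
         (S : {linear rep_space r -> rep_space r}),
    [/\ positive_op S,
        forall z, S (S z) = rep_A r (rep_B r z) &
        forall x y, gamma x y = hdot (S (rep_map r x)) (rep_map r y)].

(* By Pusz-Woronowicz, is_form_mean holds of exactly one gamma when alpha and
   beta are positive sesquilinear forms. *)
Definition form_mean (V : lmodType C) (alpha beta : V -> V -> C)
    : V -> V -> C :=
  xget (fun _ _ => 0) (is_form_mean alpha beta).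

(* M_m (.) L^2(M_n) is 'M_(m * n), the simple tensor of x and xi being
   x *t xi. The sum extends the formula on simple tensors (cp_formE)
   sesquilinearly (cp_form_sesquilinear), writing u as the sum of the
   delta_mx i j *t tens_block u i j. *)
Definition cp_form (m n : nat) (Phi : 'M[C]_m -> 'M[C]_n)
    (u v : 'M[C]_(m * n)) : C :=
  \sum_(i < m) \sum_(j < m) \sum_(k < m) \sum_(l < m)
    L2dot (Phi ((delta_mx k l) ^t* *m delta_mx i j) *m tens_block u i j)
          (tens_block v k l).

Lemma cp_formE (m n : nat) (Phi : {linear 'M[C]_m -> 'M[C]_n})
    (x y : 'M[C]_m) (xi eta : 'M[C]_n) :
  cp_form Phi (x *t xi) (y *t eta) = L2dot (Phi (y ^t* *m x) *m xi) eta.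
Proof.
have blockE (z : 'M[C]_m) (ze : 'M[C]_n) i j :
    tens_block (z *t ze) i j = z i j *: ze.
  by apply/matrixP => a b; rewrite !mxE !mxtens_indexK.
have termE i j k l :
  L2dot (Phi ((delta_mx k l) ^t* *m delta_mx i j) *m tens_block (x *t xi) i j)
        (tens_block (y *t eta) k l) =
  L2dot (Phi ((y k l *: delta_mx k l) ^t* *m (x i j *: delta_mx i j)) *m xi) eta.
  rewrite !blockE /L2dot !linearZ /= !map_mxZ -!scalemxAl -!scalemxAr.
  by rewrite !linearZ /= -?scalemxAl -?scalemxAr !linearZ /= mulrCA.
rewrite /cp_form.
under eq_bigr do under eq_bigr do under eq_bigr do under eq_bigr do
  rewrite termE.
rewrite [in RHS](matrix_sum_delta x) [in RHS](matrix_sum_delta y).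
have L2l (u v w : 'M[C]_n) : L2dot (u + v) w = L2dot u w + L2dot v w.
  by rewrite /L2dot mulmxDr linearD mulrDr.
have F0 : L2dot (Phi 0 *m xi) eta = 0 by
  rewrite /L2dot linear0 mul0mx mulmx0 mxtrace0 mulr0.
pose F (w z : 'M[C]_m) : C := L2dot (Phi (z ^t* *m w) *m xi) eta.
have F0l z : F 0 z = 0 by rewrite /F /= mulmx0.
have F0r w : F w 0 = 0 by rewrite /F trmx0 map_mx0 mul0mx.
have FDl z : {morph F ^~ z : a b / a + b}.
  by move=> a b; rewrite /F mulmxDr linearD mulmxDl L2l.
have FDr w : {morph F w : a b / a + b}.
  by move=> a b; rewrite /F linearD map_mxD mulmxDl linearD mulmxDl L2l.
rewrite -[RHS]/(F _ _).
rewrite (big_morph _ (FDl _) (F0l _)); apply: eq_bigr => i _.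
rewrite (big_morph _ (FDl _) (F0l _)); apply: eq_bigr => j _.
rewrite (big_morph _ (FDr _) (F0r _)); apply: eq_bigr => k _.
by rewrite (big_morph _ (FDr _) (F0r _)).
Qed.

Lemma cp_form_sesquilinear (m n : nat) (Phi : {linear 'M[C]_m -> 'M[C]_n}) :
  bilinear_for *%R (Num.conj \; *%R) (cp_form Phi).
Proof.
have bD (a : C) (u v : 'M[C]_(m * n)) i j :
    tens_block (a *: u + v) i j = a *: tens_block u i j + tens_block v i j.
  by apply/matrixP => k l; rewrite !mxE.
by split=> w a u v; rewrite /cp_form [a *: _]/GRing.scale /=;
  rewrite mulr_sumr -big_split /=; apply: eq_bigr => i _;
  rewrite mulr_sumr -big_split /=; apply: eq_bigr => j _;
  rewrite mulr_sumr -big_split /=; apply: eq_bigr => k _;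
  rewrite mulr_sumr -big_split /=; apply: eq_bigr => l _; rewrite bD /L2dot;
  [rewrite mulmxDr -scalemxAr mulmxDr -scalemxAr
  |rewrite linearP /= map_mxD map_mxZ mulmxDl -scalemxAl];
  rewrite linearP mulrDr mulrCA.
Qed.

Definition is_cp_mean (m n : nat) (Phi Psi Theta : 'M[C]_m -> 'M[C]_n)
    : Prop :=
  [/\ linear Theta, completely_positive Theta &
      forall (x y : 'M[C]_m) (xi eta : 'M[C]_n),
        L2dot (Theta (y ^t* *m x) *m xi) eta =
        form_mean (cp_form Phi) (cp_form Psi) (x *t xi) (y *t eta)].

(* is_cp_mean holds of exactly one map when Phi and Psi are completely
   positive. *)
Definition cp_mean (m n : nat) (Phi Psi : 'M[C]_m -> 'M[C]_n)
    : 'M[C]_m -> 'M[C]_n :=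
  xget (fun=> 0) (is_cp_mean Phi Psi).

End FormMean.

(* Main.v *)
(* In coordinates where the form of a completely positive map Phi is
   y, x |-> y^* (C_Phi (x) 1) x / n, both geometric means become the mean of a
   pair of positive semidefinite matrices, and everything reduces to one fact:
   if a = T^* A T and b = T^* B T with T invertible and A, B commuting, then
   T^* (A B)^(1/2) T is the largest Y with [a Y; Y b] >= 0.  A simultaneous
   reduction of C_Phi and C_Psi to such a pair exists, and it provides a
   compatible representation on a finite dimensional Hilbert space.  Conversely,
   in any compatible representation of forms on a finite dimensional space the
   dense range is the whole Hilbert space, so that the form of (A B)^(1/2) is
   again the largest matrix above, computed through the Gram matrix. *)
Require Import Defs.
From HB Require Import structures.
From mathcomp Require Import all_boot all_order all_algebra.
From mathcomp Require Import all_classical all_reals all_analysis.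
From mathcomp Require Import complex mxtens ring.

Set Implicit Arguments.
Unset Strict Implicit.
Unset Printing Implicit Defensive.

Import Order.TTheory GRing.Theory Num.Theory.
Import numFieldNormedType.Exports.
Local Open Scope classical_set_scope.
Local Open Scope ring_scope.
Local Open Scope sesquilinear_scope.

(** * Positive semidefinite matrices and their geometric mean *)

Section Psd.
Variable C : numClosedFieldType.
Implicit Types d k : nat.

(** * Adjoints, quadratic forms and the spectral theorem *)

Lemma adjmxM m n p (A : 'M[C]_(m, n)) (B : 'M[C]_(n, p)) :
  (A *m B) ^t* = B ^t* *m A ^t*.
Proof. by rewrite trmx_mul map_mxM. Qed.

Lemma adjmxD m n (A B : 'M[C]_(m, n)) : (A + B) ^t* = A ^t* + B ^t*.
Proof. by rewrite linearD map_mxD. Qed.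

Lemma adjmxB m n (A B : 'M[C]_(m, n)) : (A - B) ^t* = A ^t* - B ^t*.
Proof. by rewrite linearB map_mxB. Qed.

Lemma adjmxZ m n a (A : 'M[C]_(m, n)) : (a *: A) ^t* = a^* *: A ^t*.
Proof. by rewrite linearZ map_mxZ. Qed.

Lemma adjmx1 n : (1%:M : 'M[C]_n) ^t* = 1%:M.
Proof. by rewrite trmx1 map_mx1. Qed.

Lemma conj_mxE m n (A : 'M[C]_(m, n)) i j : (A i j)^* = (A ^t*) j i.
Proof. by rewrite !mxE. Qed.

Lemma adj_diag_mx n (u : 'rV[C]_n) : (diag_mx u) ^t* = diag_mx (map_mx Num.conj u).
Proof. by rewrite tr_diag_mx map_diag_mx. Qed.

Lemma adj_invmx n (A : 'M[C]_n) : (invmx A) ^t* = invmx (A ^t*).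
Proof. by rewrite trmx_inv map_invmx. Qed.

Lemma normsqE d (v : 'cV[C]_d) : (v ^t* *m v) 0 0 = \sum_i `|v i 0| ^+ 2.
Proof.
by rewrite mxE; apply: eq_bigr => i _; rewrite !mxE mulrC normCK.
Qed.

Lemma normsq_ge0 d (v : 'cV[C]_d) : 0 <= (v ^t* *m v) 0 0.
Proof. by rewrite normsqE; apply: sumr_ge0 => i _; rewrite exprn_ge0. Qed.

Lemma normsq_eq0 d (v : 'cV[C]_d) : ((v ^t* *m v) 0 0 == 0) = (v == 0).
Proof.
apply/idP/eqP => [|->]; last by rewrite mulmx0 mxE.
rewrite normsqE psumr_eq0 => [/allP v0|i _]; last exact: exprn_ge0.
apply/matrixP => i j; rewrite ord1 mxE; apply/eqP.
by have := v0 i (mem_index_enum i); rewrite /= sqrf_eq0 normr_eq0.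
Qed.

(** Polarization: for the difference [K], expanding the form at [e i + e j] gives K_ij + K_ji = 0,
    and at [e i + 'i *: e j] it gives K_ij = K_ji. *)
Lemma eq_quad d (M N : 'M[C]_d) :
  (forall v : 'cV[C]_d, (v ^t* *m M *m v) 0 0 = (v ^t* *m N *m v) 0 0) -> M = N.
Proof.
move=> MN; apply/subr0_eq; set K := M - N.
have K0 (v : 'cV[C]_d) : (v ^t* *m K *m v) 0 0 = 0.
  by rewrite /K mulmxBr mulmxBl mxE [X in _ + X]mxE MN subrr.
pose q (u v : 'cV[C]_d) := (u ^t* *m K *m v) 0 0.
have qDl u v w : q (u + v) w = q u w + q v w.
  by rewrite /q adjmxD !mulmxDl [LHS]mxE.
have qDr u v w : q u (v + w) = q u v + q u w.
  by rewrite /q mulmxDr [LHS]mxE.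
have sum0 u v : q u v + q v u = 0.
  have : q (u + v) (u + v) = 0 by apply: K0.
  by rewrite qDl !qDr [q u u]K0 [q v v]K0 addr0 add0r.
pose e (k : 'I_d) : 'cV[C]_d := delta_mx k 0.
have eKe (k l : 'I_d) : q (e k) (e l) = K k l.
  by rewrite /q /e trmx_delta map_delta_mx -rowE -colE !mxE.
apply/matrixP => i j; rewrite [RHS]mxE.
have := sum0 (e i) (e j); have := sum0 (e i) ('i *: e j).
have -> : q (e i) ('i *: e j) = 'i * K i j by rewrite -eKe /q -scalemxAr mxE.
have -> : q ('i *: e j) (e i) = - 'i * K j i.
  by rewrite -eKe /q adjmxZ conjCi -!scalemxAl mxE.
rewrite !eKe mulNr -mulrBr => /eqP.
rewrite mulf_eq0 (negbTE (neq0Ci _)) /= subr_eq0 => /eqP ->.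
by move=> /eqP; rewrite -mulr2n mulrn_eq0 /= => /eqP.
Qed.

Lemma gram_eq0 d k (W : 'M[C]_(d, k)) : W ^t* *m W = 0 -> W = 0.
Proof.
move=> WW; apply/matrixP => i j.
have : ((col j W) ^t* *m col j W) 0 0 == 0.
  by rewrite colE adjmxM -mulmxA [W ^t* *m _]mulmxA WW mul0mx mulmx0 mxE.
by rewrite normsq_eq0 => /eqP/matrixP/(_ i 0); rewrite !mxE.
Qed.

Lemma herm_spectral d (A : 'M[C]_d) : A ^t* = A ->
  exists P (u : 'rV[C]_d), [/\ P ^t* *m P = 1%:M, P *m P ^t* = 1%:M,
    A = P ^t* *m diag_mx u *m P & forall i, u 0 i \is Num.real].
Proof.
move=> Ah; have Aherm : A \is hermsymmx.
  by apply/is_hermitianmxP; rewrite expr0 scale1r Ah.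
exists (spectralmx A), (spectral_diag A).
have Pu := spectral_unitarymx A; have Pi := invmx_unitary Pu.
split.
- by rewrite -Pi mulVmx // spectral_unit.
- by rewrite -Pi mulmxV // spectral_unit.
- by rewrite -Pi; apply/orthomx_spectralP/hermitian_normalmx.
- by move=> i; apply: (mxOverP (hermitian_spectral_diag_real Aherm)).
Qed.

Lemma unitary_diag_mul d (P : 'M[C]_d) (u w : 'rV[C]_d) : P *m P ^t* = 1%:M ->
  (P ^t* *m diag_mx u *m P) *m (P ^t* *m diag_mx w *m P) =
  P ^t* *m diag_mx (\row_i (u 0 i * w 0 i)) *m P.
Proof.
move=> PP; rewrite -mulmx_diag; move: (diag_mx u) (diag_mx w) => U W.
by rewrite !mulmxA -[_ *m P *m P ^t*]mulmxA PP mulmx1.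
Qed.

(* At C = R[i] this is convertible to psdmx. *)
Definition psd d (A : 'M[C]_d) : Prop :=
  forall v : 'cV[C]_d, 0 <= (v ^t* *m A *m v) 0 0.

(** * Positive semidefinite matrices and their square roots *)

(** The values of the form are real, so [A] and its adjoint have the same quadratic form. *)
Lemma psd_herm d (A : 'M[C]_d) : psd A -> A ^t* = A.
Proof.
move=> Apsd; apply: eq_quad => v.
have /ger0_real/CrealP <- := Apsd v.
by rewrite conj_mxE !adjmxM trmxCK mulmxA.
Qed.

Lemma psd0 d : psd (0 : 'M[C]_d).
Proof. by move=> v; rewrite mulmx0 mul0mx mxE. Qed.

Lemma psdD d (A B : 'M[C]_d) : psd A -> psd B -> psd (A + B).
Proof.
by move=> Ap Bp v; rewrite mulmxDr mulmxDl mxE addr_ge0.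
Qed.

Lemma psdZ d a (A : 'M[C]_d) : 0 <= a -> psd A -> psd (a *: A).
Proof.
by move=> a0 Ap v; rewrite -scalemxAr -scalemxAl mxE mulr_ge0.
Qed.

Lemma psd_congr d k (T : 'M[C]_(d, k)) (A : 'M[C]_d) :
  psd A -> psd (T ^t* *m A *m T).
Proof. by move=> Ap v; have := Ap (T *m v); rewrite adjmxM !mulmxA. Qed.

Lemma psd_gram d k (T : 'M[C]_(d, k)) : psd (T ^t* *m T).
Proof. by move=> v; rewrite mulmxA -adjmxM -mulmxA normsq_ge0. Qed.

Lemma psd1 d : psd (1%:M : 'M[C]_d).
Proof. by move=> v; rewrite mulmx1 normsq_ge0. Qed.

Lemma psd_diag d (u : 'rV[C]_d) : (forall i, 0 <= u 0 i) -> psd (diag_mx u).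
Proof.
move=> u0 v; rewrite -mulmxA mul_diag_mx mxE; apply: sumr_ge0 => i _.
by rewrite !mxE mulrCA mulr_ge0 // mulrC mul_conjC_ge0.
Qed.

Lemma psd_anti d (A B : 'M[C]_d) : psd (A - B) -> psd (B - A) -> A = B.
Proof.
move=> AB BA; apply: eq_quad => v; apply/le_anti.
have sub (M N : 'M[C]_d) :
    (v ^t* *m (M - N) *m v) 0 0 = (v ^t* *m M *m v) 0 0 - (v ^t* *m N *m v) 0 0.
  by rewrite mulmxBr mulmxBl mxE [X in _ + X]mxE.
by rewrite -subr_ge0 -sub BA -subr_ge0 -sub AB.
Qed.

(** Each eigenvalue is the value of the form at the unit eigenvector [P ^t* *m delta_mx i 0]. *)
Lemma psd_spectral d (A : 'M[C]_d) : psd A ->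
  exists P (u : 'rV[C]_d), [/\ P ^t* *m P = 1%:M, P *m P ^t* = 1%:M,
    A = P ^t* *m diag_mx u *m P & forall i, 0 <= u 0 i].
Proof.
move=> Ap; have [P [u [PP PP' AE _]]] := herm_spectral (psd_herm Ap).
exists P, u; split=> // i.
have := Ap (P ^t* *m delta_mx i 0).
rewrite AE adjmxM trmxCK !mulmxA mulmxtVK; last exact/unitarymxP.
rewrite -[_ *m P *m _]mulmxA PP' mulmx1 trmx_delta map_delta_mx -rowE -colE.
by rewrite !mxE eqxx mulr1n.
Qed.

Lemma psd_sqrt d (A : 'M[C]_d) : psd A ->
  exists2 S, psd S & S *m S = A.
Proof.
move=> /psd_spectral [P [u [PP PP' -> u0]]].
exists (P ^t* *m diag_mx (\row_i sqrtC (u 0 i)) *m P).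
  by apply/psd_congr/psd_diag => i; rewrite mxE sqrtC_ge0.
rewrite unitary_diag_mul // (_ : \row_i (_ * _) = u) //.
by apply/rowP => i; rewrite !mxE -expr2 sqrtCK.
Qed.

(** With A = S S and S hermitian, the hypothesis says that the Gram matrix of [S *m v] vanishes. *)
Lemma psd_ker d k (A : 'M[C]_d) (v : 'M[C]_(d, k)) : psd A ->
  v ^t* *m A *m v = 0 -> A *m v = 0.
Proof.
move=> /psd_sqrt [S Sp <-] vAv; rewrite -mulmxA.
suff -> : S *m v = 0 by rewrite mulmx0.
by apply: gram_eq0; rewrite adjmxM (psd_herm Sp) -vAv !mulmxA.
Qed.

(* On an eigenbasis of S, (s_i^2 - s_j^2) M_ij = 0 forces (s_i - s_j) M_ij = 0. *)
Lemma psd_sqr_comm d (S M : 'M[C]_d) : psd S ->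
  S *m S *m M = M *m (S *m S) -> S *m M = M *m S.
Proof.
move=> /psd_spectral [P [u [PP PP' -> u0]]]; rewrite unitary_diag_mul // => SM.
have PtK (X : 'M[C]_d) : P *m (P ^t* *m X *m P) *m P ^t* = X.
  by rewrite !mulmxA PP' mul1mx -mulmxA PP' mulmx1.
set N := P *m M *m P ^t*.
have comm (w : 'rV[C]_d) :
    P ^t* *m diag_mx w *m P *m M = P ^t* *m (diag_mx w *m N) *m P.
  by rewrite /N -!mulmxA PP mulmx1.
have comm' (w : 'rV[C]_d) :
    M *m (P ^t* *m diag_mx w *m P) = P ^t* *m (N *m diag_mx w) *m P.
  by rewrite /N !mulmxA PP mul1mx.
rewrite comm comm'; rewrite comm comm' in SM.
have {}SM := congr1 (fun X => P *m X *m P ^t*) SM; rewrite !PtK in SM.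
congr (_ *m _ *m _).
apply/matrixP => i j; move/matrixP/(_ i j): SM.
rewrite !mul_diag_mx !mul_mx_diag !mxE.
move: (N i j) => x /eqP; rewrite [X in _ == X]mulrC -subr_eq0 -mulrBl.
rewrite mulf_eq0 => /orP[|/eqP->].
  by rewrite -!expr2 subr_eq0 eqrXn2 // => /eqP->; apply: mulrC.
by rewrite mulr0 mul0r.
Qed.

(** The square root S of A commutes with B as well, so A B = S B S is a congruence of B. *)
Lemma psd_mul_comm d (A B : 'M[C]_d) : psd A -> psd B ->
  A *m B = B *m A -> psd (A *m B).
Proof.
move=> /psd_sqrt [S Sp <-] Bp comm; rewrite -mulmxA (psd_sqr_comm Sp comm).
by rewrite mulmxA -{1}(psd_herm Sp); apply: psd_congr.
Qed.

(** The roots commute, so D = S - T satisfies D S D + D T D = (S^2 - T^2) D = 0. Both terms are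
    positive, hence zero, which gives S D = T D = 0 and then D^2 = 0. *)
Lemma psd_sqrt_uniq d (S T : 'M[C]_d) : psd S -> psd T ->
  S *m S = T *m T -> S = T.
Proof.
move=> Sp Tp SS.
have ST : S *m T = T *m S.
  by apply: psd_sqr_comm => //; rewrite SS mulmxA.
set D := S - T.
have Dh : D ^t* = D by rewrite adjmxB !psd_herm.
have sum0 : D ^t* *m S *m D + D ^t* *m T *m D = 0.
  rewrite -mulmxDl -mulmxDr Dh {1}/D mulmxDr !mulmxBl ST SS addrA subrK subrr.
  by rewrite mul0mx.
have [DS DT] : D ^t* *m S *m D = 0 /\ D ^t* *m T *m D = 0.
  have Xp := psd_congr D Sp; have Yp := psd_congr D Tp.
  move/eqP: sum0; rewrite addr_eq0 => /eqP XY.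
  have X0 : D ^t* *m S *m D = 0.
    by apply: psd_anti; rewrite ?sub0r ?subr0 // XY opprK.
  by split=> //; rewrite -[LHS]opprK -XY X0 oppr0.
have DD : D *m D = 0.
  by rewrite {1}/D mulmxBl (psd_ker Sp DS) (psd_ker Tp DT) subrr.
apply/subr0_eq; rewrite -/D -[D]mul1mx; apply: psd_ker; first exact: psd1.
by rewrite mulmx1 Dh.
Qed.

Lemma psd_of_diag d (P : 'M[C]_d) (u : 'rV[C]_d) :
  (forall i, 0 <= u 0 i) -> psd (P ^t* *m diag_mx u *m P).
Proof. by move=> u0; apply/psd_congr/psd_diag. Qed.

(* For an eigenvector x of Q - P of eigenvalue l < 0,
   |P x|^2 = |Q x|^2 - 2 l (x, Q x) + l^2 |x|^2 > |Q x|^2. *)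
Lemma psd_sqr_mono d (P Q : 'M[C]_d) : P ^t* = P -> psd Q ->
  psd (Q *m Q - P *m P) -> psd (Q - P).
Proof.
move=> Ph Qp QP.
have QPh : (Q - P) ^t* = Q - P by rewrite adjmxB Ph psd_herm.
have [U [u [UU UU' QPE ur]]] := herm_spectral QPh.
rewrite QPE; apply: psd_of_diag => i.
pose x := U ^t* *m delta_mx i (0 : 'I_1).
have QPx : (Q - P) *m x = u 0 i *: x.
  rewrite QPE /x !mulmxA -(mulmxA _ U) UU' mulmx1 -mulmxA scalemxAr.
  congr (_ *m _); apply/matrixP => k l; rewrite mul_diag_mx !mxE.
  by case: eqVneq => [->|]; rewrite ?mulr0.
have xx : (x ^t* *m x) 0 0 = 1.
  rewrite /x adjmxM trmxCK mulmxA -(mulmxA _ U) UU' mulmx1.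
  by rewrite trmx_delta map_delta_mx mul_delta_mx mxE eqxx.
have Px : P *m x = Q *m x - u 0 i *: x.
  by rewrite -QPx mulmxBl opprB addrC subrK.
have Ph' : P *m P = P ^t* *m P by rewrite Ph.
have Qh' : Q *m Q = Q ^t* *m Q by rewrite (psd_herm Qp).
have uc : (u 0 i)^* = u 0 i by apply/CrealP.
have qE : ((Q *m x) ^t* *m x) 0 0 = (x ^t* *m (Q *m x)) 0 0.
  by rewrite adjmxM (psd_herm Qp) mulmxA.
have := QP x; rewrite Ph' Qh' mulmxBr mulmxBl !mulmxA -!adjmxM -!mulmxA Px.
rewrite adjmxB adjmxZ uc !(mulmxBl, mulmxBr) -!scalemxAl -!scalemxAr.
have := Qp x; rewrite -mulmxA; move: qE xx.
move: (_ *m x) (_ *m x) (x ^t* *m _) ((Q *m x)^t* *m (Q *m x)).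
move=> M1 M2 M3 M4 E1 E2 q0.
rewrite !mxE E1 E2; move: (M3 0 0) q0 => q q0.
rewrite (_ : _ - _ = 2 * u 0 i * q - u 0 i ^+ 2); last by ring.
move=> le0; rewrite real_leNgt ?ur ?real0 //; apply/negP => u0; move: le0.
rewrite lt_geF // subr_lt0; apply: (@le_lt_trans _ _ 0).
  by rewrite mulrAC nmulr_lle0 // mulr_ge0.
by rewrite -[u 0 i]opprK sqrrN exprn_gt0 // oppr_gt0.
Qed.

(* At C = R[i] this is convertible to is_psdmx_mean. *)
Definition is_psd_mean d (A B X : 'M[C]_d) : Prop :=
  let admissible Y := psd Y /\ psd (block_mx A Y Y B) in
  admissible X /\ forall Y, admissible Y -> psd (X - Y).

Lemma is_psd_mean_uniq d (A B X Y : 'M[C]_d) :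
  is_psd_mean A B X -> is_psd_mean A B Y -> X = Y.
Proof. move=> [Xa Xm] [Ya Ym]; exact: psd_anti (Xm _ Ya) (Ym _ Xa). Qed.

(** * The mean of two commuting matrices *)

Lemma psd_lim d (M : 'M[C]_d) : M ^t* = M ->
  (forall e, 0 < e -> psd (M + e *: 1%:M)) -> psd M.
Proof.
move=> Mh Me v; set x := _ 0 0.
have xr : x \is Num.real.
  by apply/CrealP; rewrite /x conj_mxE !adjmxM trmxCK Mh mulmxA.
have Mex e : 0 < e -> 0 <= x + e * (v ^t* *m v) 0 0.
  move=> /Me /(_ v).
  by rewrite mulmxDr mulmxDl mxE -scalemxAr -scalemxAl mulmx1 [X in _ + X]mxE.
have := normsq_ge0 v; move: ((v ^t* *m v) 0 0) Mex => c Mex c0.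
have c1 : 0 < c + 1 by rewrite ltr_wpDl.
rewrite real_leNgt ?real0 //; apply/negP => x0.
(* This choice turns x + e c into x / (c + 1), which is negative along with x. *)
have e0 : 0 < - x / (c + 1) by rewrite divr_gt0 // oppr_gt0.
have := Mex _ e0; rewrite (_ : _ + _ = x / (c + 1)); last first.
  by field; rewrite gt_eqF.
by rewrite lt_geF // pmulr_llt0 ?invr_gt0.
Qed.

Lemma psd_bounded d (B : 'M[C]_d) : psd B ->
  exists2 b, 0 < b & psd (b *: 1%:M - B).
Proof.
move=> /psd_spectral [P [u [PP PP' -> u0]]].
(* The trace bounds every eigenvalue; adding 1 makes the bound positive even when all of them
   vanish. *)
exists (\sum_i u 0 i + 1); first by rewrite ltr_wpDl // sumr_ge0.
set b := (X in X *: _).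
have -> : b *: 1%:M = P ^t* *m diag_mx (const_mx b) *m P.
  by rewrite diag_const_mx -(scalemx1 _ b) -scalemxAr -scalemxAl mulmx1 PP.
rewrite -mulmxBl -mulmxBr -linearB; apply: psd_of_diag => i.
rewrite !mxE subr_ge0 /b (bigD1 i) //= -addrA lerDl addr_ge0 //.
by apply: sumr_ge0.
Qed.

Lemma psd_shift_sqrt d (A : 'M[C]_d) e : psd A -> 0 < e ->
  exists r, [/\ psd r, r \in unitmx & r *m r = A + e *: 1%:M].
Proof.
move=> /psd_spectral [P [u [PP PP' -> u0]]] e0.
have ue i : 0 < u 0 i + e by rewrite ltr_wpDl.
exists (P ^t* *m diag_mx (\row_i sqrtC (u 0 i + e)) *m P); split.
- by apply: psd_of_diag => i; rewrite mxE sqrtC_ge0 ltW.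
- have [Pt Pu] := mulmx1_unit PP.
  rewrite !unitmx_mul Pt Pu andbT /= unitmxE det_diag unitfE.
  by apply/prodf_neq0 => i _; rewrite mxE sqrtC_eq0 gt_eqF.
rewrite unitary_diag_mul // -[1%:M]PP -[X in _ + _ *: (X *m _)]mulmx1.
rewrite scalemxAl scalemxAr -mulmxDl -mulmxDr scalemx1 -diag_const_mx -linearD.
congr (_ *m diag_mx _ *m _); apply/rowP => i.
by rewrite !mxE -expr2 sqrtCK.
Qed.

Lemma comm_invmx d (r M : 'M[C]_d) : r \in unitmx -> r *m M = M *m r ->
  invmx r *m M = M *m invmx r.
Proof.
move=> ru rM; apply: (can_inj (mulKmx ru)).
by rewrite mulmxA mulmxV // mul1mx mulmxA rM -mulmxA mulmxV // mulmx1.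
Qed.

(* Schur complement: Y q^2 Y <= B <= S q^2 S, i.e. (q Y q)^2 <= (q S q)^2. *)
Lemma psd_block_max d (r B S Y : 'M[C]_d) (q := invmx r) :
  r ^t* = r -> r \in unitmx -> psd S -> Y ^t* = Y ->
  psd (block_mx (r *m r) Y Y B) -> psd (S *m q *m q *m S - B) ->
  psd (S - Y).
Proof.
move=> rh ru Sp Yh bp SB.
have qh : q ^t* = q by rewrite adj_invmx rh.
have BY : psd (B - Y *m q *m q *m Y).
  (* The first block row kills this column because q^2 inverts r^2, so the congruence leaves the
     Schur complement B - Y q^2 Y. *)
  have := psd_congr (col_mx (- (q *m q *m Y)) 1%:M) bp.
  rewrite -mulmxA mul_block_col !mulmx1 tr_col_mx map_row_mx mul_row_col.
  rewrite adjmx1 mul1mx !mulmxN [_ *m (q *m q *m Y)]mulmxA.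
  rewrite [_ *m (q *m q)]mulmxA mulmxK // mulmxV // mul1mx addNr mulmx0 add0r.
  by rewrite addrC !mulmxA.
have SY : psd (S *m q *m q *m S - Y *m q *m q *m Y).
  by have := psdD SB BY; rewrite addrA subrK.
have : psd (q *m S *m q - q *m Y *m q).
  apply: psd_sqr_mono.
  - by rewrite !adjmxM qh Yh mulmxA.
  - by rewrite -{1}qh; apply: psd_congr.
  - by have := psd_congr q SY; rewrite qh mulmxBr mulmxBl !mulmxA.
move=> /(psd_congr r); rewrite rh mulmxBr mulmxBl !mulmxA mulmxV // mul1mx.
by rewrite -!mulmxA mulVmx // !mulmx1 mul1mx.
Qed.

Lemma is_psd_mean_comm d (A B S : 'M[C]_d) : psd A -> psd B -> psd S ->
  A *m B = B *m A -> S *m S = A *m B -> is_psd_mean A B S.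
Proof.
move=> Ap Bp Sp AB SS; split.
  split=> //; have [a ap aA] := psd_sqrt Ap; have [b bp bB] := psd_sqrt Bp.
  have aB : a *m B = B *m a by apply: psd_sqr_comm => //; rewrite aA.
  have ba : b *m a = a *m b by apply: psd_sqr_comm => //; rewrite bB.
  (* By uniqueness of square roots S is the product of the roots of A and B, and the block matrix is
     the Gram matrix of the row (a b). *)
  have -> : S = a *m b.
    apply: psd_sqrt_uniq => //; first by apply: psd_mul_comm; rewrite ?ba.
    by rewrite SS -aA -bB !mulmxA -(mulmxA a b a) ba !mulmxA.
  have := psd_gram (row_mx a b).
  rewrite tr_row_mx map_col_mx mul_col_row !psd_herm // aA bB ba; exact.
move=> Y [Yp bp]; have Yh := psd_herm Yp; have Sh := psd_herm Sp.
(* With B <= b, the matrices T = S + e and r^2 = A + e^2/b satisfy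
   T^2 >= r^2 B, and r is invertible. *)
apply: psd_lim; first by rewrite adjmxB Sh Yh.
move=> e e0; have [b b0 bB] := psd_bounded Bp.
have [//|r [rp ru rA]] := @psd_shift_sqrt _ A (e ^+ 2 / b) Ap.
  by rewrite divr_gt0 ?exprn_gt0.
set T := S + e *: 1%:M.
have Tp : psd T by apply: psdD => //; apply: psdZ; rewrite ?ltW //; apply: psd1.
have rB : r *m B = B *m r.
  apply: psd_sqr_comm => //.
  by rewrite rA mulmxDl mulmxDr AB -scalemxAl -scalemxAr mulmx1 mul1mx.
have SA : S *m A = A *m S.
  by apply: psd_sqr_comm => //; rewrite SS -mulmxA AB.
have rT : r *m T = T *m r.
  apply: psd_sqr_comm => //; rewrite rA /T !(mulmxDl, mulmxDr) SA.
  rewrite -!scalemxAl -!scalemxAr !mul1mx !mulmx1.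
  by rewrite addrACA !scalerA [e * _]mulrC.
(* The block matrix stays positive when its corner A grows to r^2. What remains is T q^2 T >= B with
   q = r^-1, that is T^2 >= r^2 B, since q commutes with T and B. *)
rewrite addrAC -/T; apply: (@psd_block_max _ r B) => //; first exact: psd_herm.
  rewrite rA -[Y in block_mx _ Y _ _]addr0 -[Y in block_mx _ _ Y _]addr0.
  rewrite -[B in block_mx _ _ _ B]addr0 -add_block_mx; apply: psdD => //.
  have := psd_gram (row_mx (1%:M : 'M[C]_d) (0 : 'M[C]_d)).
  rewrite tr_row_mx map_col_mx mul_col_row adjmx1 trmx0 map_mx0.
  rewrite !mulmx0 mul0mx mulmx1 => /(psdZ (ltW (divr_gt0 (exprn_gt0 2 e0) b0))).
  by rewrite scale_block_mx !scaler0.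
have qT := comm_invmx ru rT; have qB := comm_invmx ru rB.
set q := invmx r in qT qB *.
have -> : T *m q *m q *m T - B = q *m (T *m T - r *m r *m B) *m q.
  rewrite mulmxBr mulmxBl -qT !mulmxA mulVmx // mul1mx -!mulmxA -qT.
  by rewrite -qB mulKVmx.
have qh : q ^t* = q by rewrite adj_invmx psd_herm.
rewrite -{1}qh; apply: psd_congr.
(* S^2 cancels A B; the shifts e and e^2/b are chosen so that the rest is a sum of two positive
   terms. *)
have -> : T *m T - r *m r *m B =
    (e *+ 2) *: S + (e ^+ 2 / b) *: (b *: 1%:M - B).
  rewrite rA /T !(mulmxDl, mulmxDr) -!scalemxAl -!scalemxAr !mul1mx !mulmx1.
  have -> : (e ^+ 2 / b) *: (b *: 1%:M - B) = e ^+ 2 *: 1%:M - (e ^+ 2 / b) *: B.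
    by rewrite scalerBr scalerA divfK ?gt_eqF.
  rewrite SS scalerA -expr2 mulr2n scalerDl -!addrA opprD.
  by do 3!rewrite [_ + (- (A *m B) + _)]addrCA; rewrite addNKr.
by apply: psdD; apply: psdZ => //; rewrite ?ltW ?pmulrn_lgt0 ?divr_gt0 ?exprn_gt0.
Qed.

(** * Congruence and the reduction to commuting pairs *)

(** Congruence by diag(T, T) preserves admissibility, and congruence by the inverse brings any
    competitor back. *)
Lemma is_psd_mean_congr d (T A B X : 'M[C]_d) : T \in unitmx ->
  is_psd_mean A B X ->
  is_psd_mean (T ^t* *m A *m T) (T ^t* *m B *m T) (T ^t* *m X *m T).
Proof.
have block_congr (U A' Y B' : 'M[C]_d) : psd (block_mx A' Y Y B') ->
    psd (block_mx (U ^t* *m A' *m U) (U ^t* *m Y *m U)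
                  (U ^t* *m Y *m U) (U ^t* *m B' *m U)).
  move=> /(psd_congr (block_mx U 0 0 U)).
  rewrite tr_block_mx map_block_mx trmx0 map_mx0 !mulmx_block.
  by rewrite !(mul0mx, mulmx0, addr0, add0r).
move=> Tu [[Xp Xb] Xm]; split.
  by split; [apply: psd_congr|apply: block_congr].
move=> Y [Yp Yb].
have TK (M : 'M[C]_d) : (invmx T) ^t* *m (T ^t* *m M *m T) *m invmx T = M.
  rewrite !mulmxA -adjmxM mulmxV // adjmx1 mul1mx.
  by rewrite -mulmxA mulmxV // mulmx1.
have /(psd_congr T) : psd (X - (invmx T) ^t* *m Y *m invmx T).
  apply: Xm; split; first exact: psd_congr.
  by have := block_congr (invmx T) _ _ _ Yb; rewrite !TK.
rewrite mulmxBr mulmxBl !mulmxA.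
by rewrite -adjmxM mulVmx // adjmx1 mul1mx -[Y *m _ *m _]mulmxA mulVmx // mulmx1.
Qed.

Lemma is_psd_mean_congr_comm d (T A B S : 'M[C]_d) : T \in unitmx ->
  psd A -> psd B -> psd S -> A *m B = B *m A -> S *m S = A *m B ->
  is_psd_mean (T ^t* *m A *m T) (T ^t* *m B *m T) (T ^t* *m S *m T).
Proof.
by move=> Tu Ap Bp Sp AB SS; apply: is_psd_mean_congr => //;
  apply: is_psd_mean_comm.
Qed.

Lemma psd_congr_idem d (G : 'M[C]_d) : psd G ->
  exists (T : 'M[C]_d) (e : 'rV[bool]_d), T \in unitmx /\
    G = T ^t* *m diag_mx (\row_i (e 0 i)%:R) *m T.
Proof.
move=> /psd_spectral [P [u [PP PP' -> u0]]].
(* Nonzero eigenvalues are absorbed through their square roots; null ones get the factor 1, which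
   keeps [T] invertible. *)
pose t := \row_i (if u 0 i == 0 then 1 else sqrtC (u 0 i)).
exists (diag_mx t *m P), (\row_i (u 0 i != 0)); split.
  have [Pt Pu] := mulmx1_unit PP.
  rewrite unitmx_mul Pu andbT unitmxE det_diag unitfE.
  apply/prodf_neq0 => i _; rewrite mxE; case: ifP => [_|/negbT].
    exact: oner_neq0.
  by rewrite sqrtC_eq0.
rewrite adjmxM adj_diag_mx !mulmxA -(mulmxA (P ^t*)) -[_ *m diag_mx t]mulmxA.
rewrite mulmx_diag -[P^t* *m _ *m _]mulmxA mulmx_diag -[RHS]mulmxA.
congr (_ *m (diag_mx _ *m _)); apply/rowP => i; rewrite !mxE.
case: eqVneq => [->|un0] /=; first by rewrite !(mulr0, mul0r).
by rewrite mul1r geC0_conj ?sqrtC_ge0 // -expr2 sqrtCK.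
Qed.

Lemma psd_diag0 d (A : 'M[C]_d) i j : psd A -> A i i = 0 -> A j i = 0.
Proof.
move=> Ap Ai; have : A *m delta_mx i (0 : 'I_1) = 0.
  apply: psd_ker => //; rewrite trmx_delta map_delta_mx -rowE -colE.
  by apply/matrixP => k l; rewrite !ord1 !mxE.
by rewrite -colE => /matrixP/(_ j 0); rewrite !mxE.
Qed.

Lemma psd_diag_ge0 d (A : 'M[C]_d) i : psd A -> 0 <= A i i.
Proof.
move=> /(_ (delta_mx i 0)); rewrite trmx_delta map_delta_mx -rowE -colE.
by rewrite !mxE.
Qed.

(* After reducing a + b to an idempotent E, the two summands A and E - A
   commute because A = E A = A E. *)
Lemma psd_simdiag d (a b : 'M[C]_d) : psd a -> psd b ->
  exists T A B, [/\ T \in unitmx, psd A, psd B, A *m B = B *m A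
    & a = T ^t* *m A *m T /\ b = T ^t* *m B *m T].
Proof.
move=> ap bp; have [T [e [Tu abE]]] := psd_congr_idem (psdD ap bp).
have TK (M : 'M[C]_d) : T ^t* *m ((invmx T) ^t* *m M *m invmx T) *m T = M.
  rewrite !mulmxA -adjmxM mulVmx // adjmx1 mul1mx.
  by rewrite -mulmxA mulVmx // mulmx1.
have TK' (M : 'M[C]_d) : (invmx T) ^t* *m (T ^t* *m M *m T) *m invmx T = M.
  rewrite !mulmxA -adjmxM mulmxV // adjmx1 mul1mx.
  by rewrite -mulmxA mulmxV // mulmx1.
set E := diag_mx _ in abE.
pose A := (invmx T) ^t* *m a *m invmx T; pose B := (invmx T) ^t* *m b *m invmx T.
have Ap : psd A by apply: psd_congr.
have Bp : psd B by apply: psd_congr.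
have ABE : A + B = E by rewrite /A /B -mulmxDl -mulmxDr abE TK'.
have [aE bE] : a = T ^t* *m A *m T /\ b = T ^t* *m B *m T by rewrite !TK.
clearbody A B.
(* Where [e] is false at j, A_jj + B_jj = 0 with both terms nonnegative, so A_jj = 0 and column j of
   A is zero. *)
have AE : A *m E = A.
  apply/matrixP => i j; rewrite mul_mx_diag !mxE.
  case: (boolP (e 0 j)) => [_|ej]; first by rewrite mulr1.
  rewrite mulr0; apply/esym; apply: psd_diag0 => //; apply/eqP.
  rewrite eq_le psd_diag_ge0 // andbT.
  have /matrixP/(_ j j) := ABE; rewrite !mxE eqxx (negbTE ej) mulr1n.
  by move=> /eqP; rewrite addr_eq0 => /eqP ->; rewrite oppr_le0 psd_diag_ge0.
have Eh : E ^t* = E.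
  rewrite adj_diag_mx; congr diag_mx; apply/rowP => i.
  by rewrite !mxE conjC_nat.
have EA : E *m A = A by rewrite -{1}(psd_herm Ap) -{1}Eh -adjmxM AE psd_herm.
exists T, A, B; split=> //.
  have -> : B = E - A by rewrite -ABE addrC addKr.
  by rewrite mulmxBr mulmxBl AE EA.
Qed.

(* The Gram matrix G plays the role of the inner product, and A, B, S are
   matrices of operators that are selfadjoint for it; congruence reduces G to
   an idempotent. *)
Lemma is_psd_mean_gram d (G A B S : 'M[C]_d) : psd G ->
  psd (G *m A) -> psd (G *m B) -> psd (G *m S) ->
  G *m A *m B = G *m B *m A -> G *m S *m S = G *m A *m B ->
  is_psd_mean (G *m A) (G *m B) (G *m S).
Proof.
move=> Gp Ap Bp Sp AB SS; have [T [e [Tu GE]]] := psd_congr_idem Gp.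
set E := diag_mx _ in GE.
have Eh : E ^t* = E.
  rewrite adj_diag_mx; congr diag_mx; apply/rowP => i.
  by rewrite !mxE conjC_nat.
have EE : E *m E = E.
  rewrite mulmx_diag; congr diag_mx; apply/rowP => i.
  by rewrite !mxE -natrM mulnb andbb.
pose F (M : 'M[C]_d) := (invmx T) ^t* *m (G *m M) *m invmx T.
have TK (M : 'M[C]_d) : T ^t* *m F M *m T = G *m M.
  rewrite /F !mulmxA -adjmxM mulVmx // adjmx1 mul1mx.
  by rewrite -mulmxA mulVmx // mulmx1.
have FE M : F M = E *m T *m M *m invmx T.
  by rewrite /F GE !mulmxA -adjmxM mulmxV // adjmx1 mul1mx.
(* [F M] is hermitian and E F M = F M, hence also F M E = F M. This is what makes the product F M F
   N correspond to G M N. *)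
have FEr M : psd (G *m M) -> F M *m E = F M.
  move=> GM; have Fh : (F M) ^t* = F M by apply/psd_herm/psd_congr.
  rewrite -Fh -{1}Eh -adjmxM; congr (_ ^t*).
  by rewrite FE !mulmxA EE.
have FM M N : psd (G *m M) ->
    F M *m F N = (invmx T) ^t* *m (G *m M *m N) *m invmx T.
  move=> GM; rewrite [F N]FE !mulmxA FEr // /F !mulmxA.
  by rewrite -[_ *m invmx T *m T]mulmxA mulVmx // mulmx1.
rewrite -!TK; apply: is_psd_mean_congr => //.
apply: is_psd_mean_comm; try exact: psd_congr.
  by rewrite !FM // AB.
by rewrite !FM // SS.
Qed.

End Psd.

(** * Tensor products *)

Section Tensor.
Variable C : numClosedFieldType.

Lemma sum_mxtens_index (V : nmodType) m n (F : 'I_(m * n) -> V) :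
  \sum_k F k = \sum_(i < m) \sum_(j < n) F (mxtens_index (i, j)).
Proof.
rewrite pair_bigA /= (reindex (@mxtens_index m n)) /=.
  by apply: eq_bigr => -[i j] _.
by exists (@mxtens_unindex m n) => i _; rewrite ?mxtens_indexK ?mxtens_unindexK.
Qed.

Lemma sum_eq_natmul (I : finType) (k : I) (F : I -> C) :
  \sum_i (i == k)%:R * F i = F k.
Proof.
rewrite (bigD1 k) //= eqxx mul1r big1 ?addr0 // => i /negbTE ->.
by rewrite mul0r.
Qed.

Lemma tens_sum_deltaE k d (F : 'I_k -> 'I_k -> 'M[C]_d) i j a b :
  (\sum_(i' < k) \sum_(j' < k) delta_mx i' j' *t F i' j')
    (mxtens_index (i, a)) (mxtens_index (j, b)) = F i j a b.
Proof.
rewrite summxE -[RHS](@sum_eq_natmul _ i (fun i' => F i' j a b)).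
apply: eq_bigr => i' _; rewrite summxE.
rewrite -[F i' j a b](@sum_eq_natmul _ j (fun j' => F i' j' a b)) mulr_sumr.
apply: eq_bigr => j' _; rewrite tensmxE mxE mulrA -natrM mulnb.
by rewrite (eq_sym i) (eq_sym j).
Qed.

Lemma tensmx11 m n : (1%:M : 'M[C]_m) *t (1%:M : 'M[C]_n) = 1%:M.
Proof.
apply/matrixP => k l; case: (mxtens_indexP k) => i a.
case: (mxtens_indexP l) => j b; rewrite tensmxE !mxE -natrM mulnb.
by rewrite (can_eq (@mxtens_indexK m n)).
Qed.

Lemma adj_tensmx m n p q (A : 'M[C]_(m, n)) (B : 'M[C]_(p, q)) :
  (A *t B) ^t* = A ^t* *t B ^t*.
Proof. by rewrite trmx_tens map_mxT. Qed.

Lemma psd_tens1 d k (A : 'M[C]_d) : psd A -> psd (A *t (1%:M : 'M[C]_k)).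
Proof.
move=> /psd_sqrt [S /psd_herm Sh <-].
rewrite -{1}Sh -[X in _ *t X](mulmx1 (1%:M : 'M[C]_k)) -{1}(adjmx1 C k).
by rewrite -tensmx_mul -adj_tensmx; apply: psd_gram.
Qed.

Lemma tens1_unit d k (T : 'M[C]_d) : T \in unitmx ->
  T *t (1%:M : 'M[C]_k) \in unitmx.
Proof.
move=> Tu; have : (invmx T *t 1%:M) *m (T *t 1%:M) = 1%:M :> 'M[C]_(d * k).
  by rewrite tensmx_mul mulVmx // mulmx1 tensmx11.
by case/mulmx1_unit.
Qed.

(** With a = 1/n this moves the normalization of the trace into the congruence matrix. *)
Lemma tens1_congr d k (T A : 'M[C]_d) a :
  (sqrtC a *: (T *t (1%:M : 'M[C]_k))) ^t* *m (A *t 1%:M) *m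
    (sqrtC a *: (T *t 1%:M)) =
  `|a| *: ((T ^t* *m A *m T) *t 1%:M).
Proof.
rewrite adjmxZ adj_tensmx adjmx1 -!scalemxAl -scalemxAr scalerA !tensmx_mul.
by rewrite !mulmx1 mulrC -normCK -normrX sqrtCK.
Qed.

(* With 'M_(m * n) read as 'M_m (x) 'M_n, the column with entry u_(i,a),(j,b)
   at position ((j,a),(i,b)); in these coordinates the form of a map is the
   Choi matrix tensored with the identity. *)
Definition choi_vec m n (u : 'M[C]_(m * n)) : 'cV[C]_((m * n) * (m * n)) :=
  \col_k u
    (mxtens_index ((mxtens_unindex (mxtens_unindex k).2).1,
                   (mxtens_unindex (mxtens_unindex k).1).2))
    (mxtens_index ((mxtens_unindex (mxtens_unindex k).1).1,
                   (mxtens_unindex (mxtens_unindex k).2).2)).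

Definition choi_unvec m n (x : 'cV[C]_((m * n) * (m * n))) : 'M[C]_(m * n) :=
  \matrix_(k, l)
    x (mxtens_index (mxtens_index ((mxtens_unindex l).1, (mxtens_unindex k).2),
                     mxtens_index ((mxtens_unindex k).1, (mxtens_unindex l).2))) 0.

Lemma choi_vecE m n (u : 'M[C]_(m * n)) i a j b :
  choi_vec u (mxtens_index (mxtens_index (j, a), mxtens_index (i, b))) 0 =
  u (mxtens_index (i, a)) (mxtens_index (j, b)).
Proof. by rewrite mxE !mxtens_indexK. Qed.

Lemma choi_unvecK m n : cancel (@choi_unvec m n) (@choi_vec m n).
Proof.
move=> x; apply/matrixP => k z; rewrite [z]ord1.
case: (mxtens_indexP k) => r s; case: (mxtens_indexP r) => j a.
by case: (mxtens_indexP s) => i b; rewrite choi_vecE mxE !mxtens_indexK.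
Qed.

Lemma choi_vecK m n : cancel (@choi_vec m n) (@choi_unvec m n).
Proof.
move=> u; apply/matrixP => k l; case: (mxtens_indexP k) => i a.
by case: (mxtens_indexP l) => j b; rewrite mxE !mxtens_indexK choi_vecE.
Qed.

Lemma choi_vec_is_linear m n : linear (@choi_vec m n).
Proof. by move=> c u v; apply/matrixP => k z; rewrite !mxE. Qed.

HB.instance Definition _ m n := GRing.isLinear.Build C _ _ *:%R (@choi_vec m n)
  (@choi_vec_is_linear m n).

Lemma choi_unvec_is_linear m n : linear (@choi_unvec m n).
Proof. by move=> c u v; apply/matrixP => k z; rewrite !mxE. Qed.

HB.instance Definition _ m n := GRing.isLinear.Build C _ _ *:%R (@choi_unvec m n)
  (@choi_unvec_is_linear m n).

Lemma tens1_form d k (M : 'M[C]_d) (x y : 'cV[C]_(d * k)) :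
  (y ^t* *m (M *t 1%:M) *m x) 0 0 =
  \sum_(s < k) \sum_(r < d) \sum_(r' < d)
    (y (mxtens_index (r, s)) 0)^* * M r r' * x (mxtens_index (r', s)) 0.
Proof.
rewrite -mulmxA mxE sum_mxtens_index exchange_big; apply: eq_bigr => s _.
apply: eq_bigr => r _; rewrite !mxE sum_mxtens_index mulr_sumr.
apply: eq_bigr => r' _.
rewrite -mulrA -[x (mxtens_index (r', s)) 0](@sum_eq_natmul _ s
  (fun s' => x (mxtens_index (r', s')) 0)) !mulr_sumr.
apply: eq_bigr => s' _; rewrite tensmxE mxE eq_sym.
by rewrite -!mulrA.
Qed.

(** Conjugation by 1 (x) K acts block by block; the ampliation of a Kraus map is thereby a sum of
    congruences. *)
Lemma ampl_conj k m n (K : 'M[C]_(m, n)) (u : 'M[C]_(k * m)) i a j b :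
  (((1%:M : 'M[C]_k) *t K) ^t* *m u *m (1%:M *t K))
    (mxtens_index (i, a)) (mxtens_index (j, b)) =
  (K ^t* *m (\matrix_(p, q) u (mxtens_index (i, p)) (mxtens_index (j, q))) *m K)
    a b.
Proof.
rewrite mxE sum_mxtens_index.
rewrite -(@sum_eq_natmul _ j (fun j' => (K ^t* *m (\matrix_(p, q)
  u (mxtens_index (i, p)) (mxtens_index (j', q))) *m K) a b)).
apply: eq_bigr => j' _; rewrite [(_ *m K) a b]mxE mulr_sumr.
apply: eq_bigr => q _; rewrite tensmxE mulrCA [1%:M _ _]mxE; congr (_ * (_ * _)).
rewrite !mxE sum_mxtens_index.
rewrite -(@sum_eq_natmul _ i (fun i' => \sum_p (K ^t*) a p *
   (\matrix_(p, q) u (mxtens_index (i', p)) (mxtens_index (j', q))) p q)).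
apply: eq_bigr => i' _; rewrite mulr_sumr; apply: eq_bigr => p _.
by rewrite !mxE !mxtens_indexK rmorphM /= rmorph_nat mulrA.
Qed.

End Tensor.

(** * Finite dimensional Hilbert spaces *)

(** A separate name for the column space: only its vector space structure is copied, and the norm
    put on it is the Euclidean one. *)
Definition hcol (R : realType) (d : nat) : Type := 'cV[R[i]]_d.

Lemma normc_le_ReIm (R : realType) (z : R[i]) :
  `|z| <= (`|complex.Re z| + `|complex.Im z|)%:C%C.
Proof.
rewrite normc_def lecR -[leRHS]ger0_norm ?addr_ge0 // -sqrtr_sqr ler_wsqrtr //.
by rewrite sqrrD !real_normK ?num_real // -addrA lerD2l addrC lerDl
  mulrn_wge0 // mulr_ge0.
Qed.

Section Hcol.
Variables (R : realType) (d : nat).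
Local Notation C := R[i].
Local Notation H := (hcol R d).

HB.instance Definition _ := Vector.copy H 'cV[C]_d.

Definition cdot (x y : H) : C := ((y : 'cV[C]_d) ^t* *m x) 0 0.

Lemma cdot_bilinear : bilinear_for *%R (Num.conj \; *%R) cdot.
Proof.
split=> w a u v; rewrite /cdot.
  by rewrite mulmxDr -scalemxAr !mxE.
by rewrite linearP map_mxD map_mxZ mulmxDl -scalemxAl !mxE.
Qed.

HB.instance Definition _ := bilinear_isBilinear.Build _ _ _ _ _ _ cdot cdot_bilinear.

Lemma cdotE (x y : H) : cdot x y = \sum_i x i 0 * (y i 0)^*.
Proof. by rewrite /cdot mxE; apply: eq_bigr => i _; rewrite !mxE mulrC. Qed.

Lemma cdot_herm (x y : H) : cdot x y = (-1) ^+ false * Num.conj (cdot y x).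
Proof.
rewrite expr0 mul1r !cdotE rmorph_sum; apply: eq_bigr => i _.
by rewrite rmorphM /= conjCK mulrC.
Qed.

HB.instance Definition _ := isHermitianSesquilinear.Build _ _ _ _ cdot cdot_herm.

Lemma cdot_gt0 (x : H) : x != 0 -> 0 < cdot x x.
Proof.
move=> xn0; rewrite cdotE lt_def; apply/andP; split; last first.
  by apply: sumr_ge0 => i _; rewrite mul_conjC_ge0.
apply: contra xn0; rewrite psumr_eq0 => [/allP x0|i _]; last exact: mul_conjC_ge0.
apply/eqP/matrixP => i j; rewrite ord1 mxE.
by apply/eqP; rewrite -mul_conjC_eq0; apply: x0; rewrite mem_index_enum.
Qed.

HB.instance Definition _ := isDotProduct.Build _ _ cdot cdot_gt0.

Lemma cnormD (x y : H) :
  sqrtC (cdot (x + y) (x + y)) <= sqrtC (cdot x x) + sqrtC (cdot y y).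
Proof. by case: (triangle_lerif cdot x y). Qed.

Lemma cnormZ (l : C) (x : H) :
  sqrtC (cdot (l *: x) (l *: x)) = `|l| * sqrtC (cdot x x).
Proof.
by rewrite dnormZ sqrtCM ?nnegrE ?dnorm_ge0 ?exprn_ge0 // sqrCK.
Qed.

Lemma cnorm0_eq0 (x : H) : sqrtC (cdot x x) = 0 -> x = 0.
Proof. by move=> /eqP; rewrite sqrtC_eq0 dnorm_eq0 => /eqP. Qed.

HB.instance Definition _ := Lmodule_isNormed.Build C H cnormD cnormZ cnorm0_eq0.

Lemma hcol_norm_sqr (x : H) : `|x| ^+ 2 = cdot x x.
Proof. exact: sqrtCK. Qed.

Lemma le_coord_hcol (x : H) i : `|x i 0| <= `|x|.
Proof.
rewrite -ler_sqr ?nnegrE // hcol_norm_sqr cdotE (bigD1 i) //= normCK lerDl.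
by apply: sumr_ge0 => j _; rewrite mul_conjC_ge0.
Qed.

Lemma le_hcol_coord (x : H) : `|x| <= \sum_i `|x i 0|.
Proof.
rewrite -ler_sqr ?nnegrE // ?sumr_ge0 // hcol_norm_sqr cdotE.
rewrite expr2 mulr_suml ler_sum // => i _.
rewrite -normCK expr2 ler_wpM2l // (bigD1 i) //= lerDl.
exact: sumr_ge0.
Qed.

(** Real and imaginary parts of coordinates are bounded by the norm, so they are Cauchy and converge
    in R; the limit is assembled from them. *)
Lemma hcol_complete (F : set_system H) :
  ProperFilter F -> cauchy F -> cvg F.
Proof.
move=> FF /cauchy_ballP Fc.
have ReIm_cvg (g : C -> R) : (forall z w : C, g (z - w) = g z - g w) ->
    (forall z : C, `|g z|%:C <= `|z|)%C ->
    forall i : 'I_d, cvg ((fun x : H => g (x i 0)) @ F).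
  move=> gB gle i; apply: R_complete; apply/cauchy_ballP => e e0.
  have eC : 0 < (e%:C)%C by rewrite ltcR.
  have := Fc _ eC; rewrite /= => Fe.
  have : \forall x & y \near F, ball (g ((x : H) i 0)) e (g ((y : H) i 0)).
    apply: (filterS _ Fe).
    move=> [x y]; rewrite -ball_normE /ball/= => xy.
    rewrite -gB -ltcR; apply: le_lt_trans (gle _) _.
    have -> : x i 0 - y i 0 = (x - y) i 0 by rewrite !mxE.
    exact: le_lt_trans (le_coord_hcol _ _) xy.
  by move=> h; rewrite near_map2.
have ReB (z w : C) : complex.Re (z - w) = complex.Re z - complex.Re w.
  by case: z w => [? ?] [].
have ImB (z w : C) : complex.Im (z - w) = complex.Im z - complex.Im w.
  by case: z w => [? ?] [].
have Imle (z : C) : (`|complex.Im z|%:C <= `|z|)%C.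
  by rewrite normc_def lecR -sqrtr_sqr ler_wsqrtr // lerDr sqr_ge0.
have cRe := ReIm_cvg _ ReB (@normc_ge_Re _).
have cIm := ReIm_cvg _ ImB Imle.
apply/cvg_ex.
exists (\col_i Complex (lim ((fun x : H => complex.Re (x i 0)) @ F))
   (lim ((fun x : H => complex.Im (x i 0)) @ F)) : H).
apply/cvgrPdist_lt => e e0.
(* A sum of 2d errors below e / (2d + 1) stays strictly below e, also when d = 0. *)
have e2 : 0 < complex.Re e / (d.*2.+1)%:R.
  by apply: divr_gt0; rewrite ?ltr0n //; move: e0; rewrite ltcE => /andP[].
have coord_near (g : C -> R) (i : 'I_d) : cvg ((fun x : H => g (x i 0)) @ F) ->
    \forall x \near F, `|lim ((fun x : H => g (x i 0)) @ F) - g ((x : H) i 0)|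
      < complex.Re e / (d.*2.+1)%:R.
  by move=> /cvgrPdist_lt; apply.
have nRe := filter_forall _ (fun i => coord_near _ i (cRe i)).
have nIm := filter_forall _ (fun i => coord_near _ i (cIm i)).
near=> x.
have xRe : forall i, `|lim (complex.Re ((x : H) i 0) @[x --> F]) - complex.Re (x i 0)|
    < complex.Re e / (d.*2.+1)%:R by near: x; exact: nRe.
have xIm : forall i, `|lim (complex.Im ((x : H) i 0) @[x --> F]) - complex.Im (x i 0)|
    < complex.Re e / (d.*2.+1)%:R by near: x; exact: nIm.
apply: le_lt_trans (le_hcol_coord _) _.
apply: (@le_lt_trans _ _ (\sum_(i < d) ((complex.Re e / (d.*2.+1)%:R) *+ 2)%:C)%C).
  apply: ler_sum => i _; rewrite !mxE.
  apply: le_trans (normc_le_ReIm _) _.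
  rewrite ReB ImB lecR mulr2n.
  exact: lerD (ltW (xRe i)) (ltW (xIm i)).
rewrite sumr_const card_ord -rmorphMn /= -[ltRHS](RRe_real (gtr0_real e0)) ltcR.
have eE : complex.Re e = complex.Re e / d.*2.+1%:R *+ d.*2.+1.
  by rewrite -mulr_natr divfK // pnatr_eq0.
rewrite [ltRHS]eE -mulrnA mul2n.
by rewrite ltr_pMn2l.
Unshelve. all: by end_near. Qed.

HB.instance Definition _ := Uniform_isComplete.Build H hcol_complete.

HB.instance Definition _ := NormedModule_isHilbert.Build R H hcol_norm_sqr.

Definition hcol_mul (M : 'M[C]_d) (x : H) : H := M *m (x : 'cV[C]_d).

Lemma hcol_mul_linear M : linear (hcol_mul M).
Proof. by move=> a x y; rewrite /hcol_mul mulmxDr -scalemxAr. Qed.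

HB.instance Definition _ M := GRing.isLinear.Build C H H *:%R (hcol_mul M)
  (hcol_mul_linear M).

Lemma hcol_mul_continuous M : continuous (hcol_mul M).
Proof.
pose K := \sum_i \sum_j `|M i j|.
have K0 : 0 <= K by apply: sumr_ge0 => i _; apply: sumr_ge0.
have leK x : `|hcol_mul M x| <= K * `|x|.
  apply: le_trans (le_hcol_coord _) _; rewrite mulr_suml ler_sum // => i _.
  rewrite mxE; apply: le_trans (ler_norm_sum _ _ _) _.
  rewrite mulr_suml ler_sum // => j _.
  by rewrite normrM ler_wpM2l // le_coord_hcol.
move=> x; apply/(@cvgrPdist_lt _ _ _ (nbhs x)) => e e0.
have K1 : 0 < K + 1 by rewrite ltr_wpDl.
near=> z; rewrite -linearB; apply: le_lt_trans (leK _) _.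
apply: (@le_lt_trans _ _ ((K + 1) * `|x - z|)).
  by rewrite ler_wpM2r // lerDl.
rewrite mulrC -ltr_pdivlMr //; near: z.
by apply: cvgr_dist_lt => //; rewrite divr_gt0.
Unshelve. all: by end_near. Qed.

Lemma hdot_hcol (x y : H) : hdot x y = ((y : 'cV[C]_d) ^t* *m x) 0 0.
Proof. by []. Qed.

Lemma hcol_mul_pos M : psdmx M -> positive_op (hcol_mul M).
Proof.
move=> Mp; split; first exact: hcol_mul_continuous.
by move=> x; rewrite hdot_hcol /hcol_mul mulmxA; apply: Mp.
Qed.

End Hcol.

(** * Gram matrices *)

Section GramMatrix.
Variables (R : realType) (H : hilbertType R) (N : nat).
Local Notation C := R[i].
Variable f : {linear 'cV[C]_N -> H}.

Definition gram_mx (T : H -> H) : 'M[C]_N :=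
  \matrix_(i, j) hdot (T (f (delta_mx j 0))) (f (delta_mx i 0)).

Lemma col_sum_delta (x : 'cV[C]_N) : x = \sum_j x j 0 *: delta_mx j 0.
Proof.
rewrite {1}(matrix_sum_delta x); apply: eq_bigr => j _.
by rewrite big_ord1.
Qed.

Lemma hdot_sumE (z : H) (y : 'cV[C]_N) :
  hdot z (f y) = \sum_i (y i 0)^* * hdot z (f (delta_mx i 0)).
Proof.
rewrite {1}(col_sum_delta y) linear_sum linear_sumr; apply: eq_bigr => i _.
by rewrite linearZ linearZr_LR.
Qed.

Lemma gram_mxE (T : {linear H -> H}) (x y : 'cV[C]_N) :
  (y ^t* *m gram_mx T *m x) 0 0 = hdot (T (f x)) (f y).
Proof.
rewrite -mulmxA mxE hdot_sumE; apply: eq_bigr => i _; rewrite !mxE; congr (_ * _).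
rewrite [in RHS](col_sum_delta x) !linear_sum linear_sumlz; apply: eq_bigr => j _.
by rewrite mxE !linearZ linearZl_LR mulrC.
Qed.

(* The projection f v of z on the range of f solves the normal equations; by
   Pythagoras no point of the range is closer to z than f v. *)
Lemma dense_range_surj : dense (range f) -> forall z, exists v, f v = z.
Proof.
move=> fdense z; pose G := gram_mx id.
pose w := \row_i hdot z (f (delta_mx i 0)).
(* The normal equations are solvable when [w] vanishes against the kernel of G^T; for [c] in that
   kernel, the conjugate of [c] is sent by [f] to a vector of norm zero. *)
have /submxP [v wE] : (w <= G^T)%MS.
  rewrite submxE; apply/eqP/matrixP => i k; rewrite ord1 [RHS]mxE.
  set c := col k (cokermx G^T).
  have fc0 : f (c ^ Num.conj) = 0.
    apply/eqP; rewrite -(dnorm_eq0 hdot) hdot_sumE; apply/eqP.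
    have Gc : G^T *m c = 0 by rewrite /c colE mulmxA mulmx_coker mul0mx.
    have oc i' : hdot (f (delta_mx i' 0)) (f (c ^ Num.conj)) = 0.
      rewrite hdot_sumE; move/matrixP/(_ i' 0): Gc; rewrite !mxE => Gc.
      rewrite -[RHS]Gc; apply: eq_bigr => j _.
      by rewrite !mxE conjCK mulrC.
    rewrite big1 // => j _.
    rewrite hermC [X in _ * (_ * _ X)](_ : _ = 0) ?rmorph0 ?mulr0 //.
    exact: oc.
  rewrite mxE.
  transitivity (hdot z (f (c ^ Num.conj))); last by rewrite fc0 linear0r.
  rewrite hdot_sumE; apply: eq_bigr => j _.
  by rewrite !mxE conjCK mulrC.
exists v^T; apply/eqP; rewrite eq_sym -subr_eq0 -normr_eq0.
have orth y : hdot (z - f v^T) (f y) = 0.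
  have orthe i : hdot (z - f v^T) (f (delta_mx i 0)) = 0.
    rewrite linearBl; apply/eqP; rewrite subr_eq0; apply/eqP.
    move/rowP/(_ i): wE; rewrite mxE => wi; apply: (etrans wi).
    rewrite [in RHS](col_sum_delta v^T) linear_sum linear_sumlz !mxE.
    by apply: eq_bigr => j _; rewrite !mxE linearZ linearZl_LR.
  by rewrite hdot_sumE big1 // => i _; rewrite orthe mulr0.
apply/negPn/negP => ne0; have e0 : 0 < `|z - f v^T| by rewrite lt_def ne0 /=.
have [||u [/interior_subset]] := fdense (ball z `|z - f v^T|)^°.
- by exists z; apply: nbhsx_ballx.
- exact: open_interior.
move=> zu [y _ fy]; move: zu; rewrite -ball_normE /ball_/= -fy.
rewrite -ltr_sqr ?nnegrE // !hdot_norm.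
have -> : z - f y = (z - f v^T) + f (v^T - y) by rewrite linearB addrA subrK.
by rewrite (hnormDd (orth _)) le_gtF // lerDl dnorm_ge0.
Qed.

(** Choosing preimages under the onto map [f] turns an operator T into a matrix [op T] with f (op T
    x) = T (f x). Then the Gram matrix of T is G times [op T], and the operator identities,
    multiplied by G, become the hypotheses of [is_psd_mean_gram], even if [f] has a kernel. *)
Lemma gram_mx_mean (A B S : {linear H -> H}) : dense (range f) ->
  positive_op A -> positive_op B -> positive_op S ->
  (forall z, A (B z) = B (A z)) -> (forall z, S (S z) = A (B z)) ->
  is_psd_mean (gram_mx A) (gram_mx B) (gram_mx S).
Proof.
move=> /dense_range_surj fsurj [_ Ap] [_ Bp] [_ Sp] AB SS.
have [s sK] := choice fsurj.
pose op (T : H -> H) : 'M[C]_N := \matrix_(i, j) (s (T (f (delta_mx j 0)))) i 0.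
have opE (T : {linear H -> H}) x : f (op T *m x) = T (f x).
  have -> : op T *m x = \sum_j x j 0 *: s (T (f (delta_mx j 0))).
    apply/matrixP => i k; rewrite ord1 summxE mxE.
    by apply: eq_bigr => j _; rewrite !mxE mulrC.
  rewrite [in RHS](col_sum_delta x) !linear_sum; apply: eq_bigr => j _.
  by rewrite !linearZ /= sK.
have gramE (T : {linear H -> H}) : gram_mx T = gram_mx idfun *m op T.
  apply: eq_quad => v; rewrite gram_mxE mulmxA -mulmxA gram_mxE.
  by rewrite opE.
have gram_psd (T : {linear H -> H}) : (forall x, 0 <= hdot (T x) x) ->
    psd (gram_mx T).
  by move=> Tp v; rewrite gram_mxE.
have GM (T T' : {linear H -> H}) (v : 'cV[C]_N) :
    (v ^t* *m (gram_mx idfun *m op T *m op T') *m v) 0 0 =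
    hdot (T (T' (f v))) (f v).
  by rewrite !mulmxA -mulmxA -mulmxA gram_mxE /= !opE.
rewrite (gramE A) (gramE B) (gramE S); apply: is_psd_mean_gram.
- by apply: gram_psd => x; apply: dnorm_ge0.
- by rewrite -gramE; apply: gram_psd.
- by rewrite -gramE; apply: gram_psd.
- by rewrite -gramE; apply: gram_psd.
- apply: eq_quad => v; apply: (etrans (GM A B v)).
  by rewrite AB; apply: (esym (GM B A v)).
- apply: eq_quad => v; apply: (etrans (GM S S v)).
  by rewrite SS; apply: (esym (GM A B v)).
Qed.

End GramMatrix.

(** * Choi matrices *)

Section Choi.
Variable R : realType.
Local Notation C := R[i].

Lemma psdmx_mean_unique d (A B X : 'M[C]_d) :
  is_psd_mean A B X -> psdmx_mean A B = X.
Proof.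
move=> AX; apply: xget_unique => [|Y AY]; first exact: AX.
exact: is_psd_mean_uniq AY AX.
Qed.

Lemma choiE m n (Phi : 'M[C]_m -> 'M[C]_n) i j a b :
  choi Phi (mxtens_index (i, a)) (mxtens_index (j, b)) = Phi (delta_mx i j) a b.
Proof. exact: (@tens_sum_deltaE _ _ _ (fun i j => Phi (delta_mx i j))). Qed.

Lemma amplE m n k (Phi : 'M[C]_m -> 'M[C]_n) (u : 'M[C]_(k * m)) i j a b :
  ampliation Phi u (mxtens_index (i, a)) (mxtens_index (j, b)) =
  Phi (tens_block u i j) a b.
Proof. exact: (@tens_sum_deltaE _ _ _ (fun i j => Phi (tens_block u i j))). Qed.

(** The row [z] lists the entries of the identity, so the blocks of the positive matrix z^* z are
    the matrix units and its ampliation is the Choi matrix. *)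
Lemma choi_psd m n (Phi : 'M[C]_m -> 'M[C]_n) :
  completely_positive Phi -> psd (choi Phi).
Proof.
move=> cp; pose z : 'rV[C]_(m * m) :=
  \row_k ((mxtens_unindex k).1 == (mxtens_unindex k).2)%:R.
have zz : psdmx (z ^t* *m z) by apply: psd_gram.
rewrite (_ : choi Phi = ampliation Phi (z ^t* *m z)); first exact: cp.
apply: eq_bigr => i _; apply: eq_bigr => j _; congr (_ *t Phi _).
apply/matrixP => a b; rewrite !mxE big_ord1 !mxE !mxtens_indexK /= conjC_nat.
by rewrite -natrM mulnb (eq_sym a) (eq_sym b).
Qed.

Lemma cp_form_choi m n (Phi : {linear 'M[C]_m -> 'M[C]_n}) (u v : 'M[C]_(m * n)) :
  cp_form Phi u v =
  ((choi_vec v) ^t* *m (n%:R^-1 *: (choi Phi *t 1%:M)) *m choi_vec u) 0 0.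
Proof.
rewrite -scalemxAr -scalemxAl mxE tens1_form mulr_sumr sum_mxtens_index.
rewrite /cp_form; apply: eq_bigr => i _.
(* The product of the adjoint of e_kl with e_ij vanishes unless k = i, and is then e_lj. *)
transitivity (\sum_(j < m) \sum_(l < m)
  L2dot (Phi (delta_mx l j) *m tens_block u i j) (tens_block v i l)).
  apply: eq_bigr => j _; rewrite exchange_big; apply: eq_bigr => l _.
  rewrite (bigD1 i) //= big1 ?addr0 => [|k /negbTE ki]; last first.
    rewrite trmx_delta map_delta_mx mul_delta_mx_cond ki mulr0n linear0.
    by rewrite mul0mx /L2dot mulmx0 mxtrace0 mulr0.
  by rewrite trmx_delta map_delta_mx mul_delta_mx_cond eqxx mulr1n.
(* The indices regroup as in [choi_vec]: row (l, c) and column (j, a) of the Choi matrix, and (i, b)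
   for the identity factor. *)
transitivity (\sum_(l < m) \sum_(j < m) \sum_(b < n) \sum_(c < n) \sum_(a < n)
  n%:R^-1 * ((v (mxtens_index (i, c)) (mxtens_index (l, b)))^* *
    Phi (delta_mx l j) c a * u (mxtens_index (i, a)) (mxtens_index (j, b)))).
  rewrite exchange_big; apply: eq_bigr => l _; apply: eq_bigr => j _.
  rewrite /L2dot /mxtrace mulr_sumr; apply: eq_bigr => b _.
  rewrite mxE mulr_sumr; apply: eq_bigr => c _.
  rewrite [(Phi _ *m _) c b]mxE !mulr_sumr; apply: eq_bigr => a _.
  by rewrite !mxE -!mulrA.
under eq_bigr do rewrite exchange_big.
rewrite exchange_big; apply: eq_bigr => b _.
rewrite sum_mxtens_index mulr_sumr; apply: eq_bigr => l _.
rewrite exchange_big mulr_sumr; apply: eq_bigr => c _.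
rewrite sum_mxtens_index mulr_sumr; apply: eq_bigr => j _.
rewrite mulr_sumr; apply: eq_bigr => a _.
by rewrite !choi_vecE choiE.
Qed.

(** * Maps in Kraus form *)

Definition kraus (I : finType) m n (K : I -> 'M[C]_(m, n)) (x : 'M[C]_m) :
    'M[C]_n := \sum_r (K r) ^t* *m x *m K r.

Lemma kraus_linear (I : finType) m n (K : I -> 'M[C]_(m, n)) : linear (kraus K).
Proof.
move=> c x y; rewrite /kraus scaler_sumr -big_split; apply: eq_bigr => r _.
by rewrite mulmxDr mulmxDl -scalemxAr -scalemxAl.
Qed.

HB.instance Definition _ (I : finType) m n (K : I -> 'M[C]_(m, n)) :=
  GRing.isLinear.Build C _ _ *:%R (kraus K) (kraus_linear K).

Lemma kraus_cp (I : finType) m n (K : I -> 'M[C]_(m, n)) :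
  completely_positive (kraus K).
Proof.
move=> k u up.
have -> : ampliation (kraus K) u =
    \sum_r (1%:M *t K r) ^t* *m u *m (1%:M *t K r).
  apply/matrixP => s t; case: (mxtens_indexP s) => i a.
  case: (mxtens_indexP t) => j b; rewrite amplE !summxE.
  by apply: eq_bigr => r _; rewrite ampl_conj.
apply: (big_ind (@psd _ _)); first exact: psd0.
  by move=> ? ?; apply: psdD.
by move=> r _; apply: psd_congr.
Qed.

(** Reshaping the rows of [K] into Kraus operators realizes any matrix K^* K as the Choi matrix of a
    completely positive map. *)
Lemma choi_kraus m n (p : nat) (K : 'M[C]_(p, m * n)) :
  choi (kraus (fun r => \matrix_(i, a) K r (mxtens_index (i, a)))) = K ^t* *m K.
Proof.
apply/matrixP => s t; case: (mxtens_indexP s) => i a.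
case: (mxtens_indexP t) => j b; rewrite choiE summxE mxE.
apply: eq_bigr => r _; rewrite -(mul_delta_mx (0 : 'I_1)) mulmxA -colE.
by rewrite -mulmxA -rowE mxE big_ord1 !mxE.
Qed.

(** * The mean of two forms in Choi coordinates *)

Section FormMean.
Variables (m n : nat) (T A B S : 'M[C]_((m * n) * (m * n))).
Hypotheses (Tu : T \in unitmx) (Ap : psd A) (Bp : psd B) (Sp : psd S).
Hypotheses (AB : A *m B = B *m A) (SS : S *m S = A *m B).

Definition congr_form (M : 'M[C]_((m * n) * (m * n))) (u v : 'M[C]_(m * n)) : C :=
  ((choi_vec v) ^t* *m (T ^t* *m M *m T) *m choi_vec u) 0 0.

Lemma congr_formE M u v : congr_form M u v =
  ((T *m choi_vec v) ^t* *m (M *m (T *m choi_vec u))) 0 0.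
Proof. by rewrite /congr_form adjmxM !mulmxA. Qed.

Definition congr_map (u : 'M[C]_(m * n)) : hcol R ((m * n) * (m * n)) :=
  T *m choi_vec u.

Lemma congr_map_linear : linear congr_map.
Proof. by move=> c u v; rewrite /congr_map linearP mulmxDr -scalemxAr. Qed.

HB.instance Definition _ := GRing.isLinear.Build C _ _ *:%R congr_map
  congr_map_linear.

Lemma congr_map_dense : dense (range congr_map).
Proof.
move=> O [z Oz] _; exists z; split=> //.
exists (choi_unvec (invmx T *m z)) => //.
by rewrite /congr_map choi_unvecK mulKVmx.
Qed.

Lemma congr_form_mean :
  is_form_mean (congr_form A) (congr_form B) (congr_form S).
Proof.
have comm z : hcol_mul A (hcol_mul B z) = hcol_mul B (hcol_mul A z).
  by rewrite /hcol_mul !mulmxA AB.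
exists (Build_compatible_rep congr_map_dense (hcol_mul_pos Ap) (hcol_mul_pos Bp)
  comm (congr_formE A) (congr_formE B)).
exists (hcol_mul S); split => /=; first exact: hcol_mul_pos.
  by move=> z; rewrite /hcol_mul !mulmxA SS.
exact: congr_formE.
Qed.

(** An arbitrary representation is pulled back to columns along [choi_unvec]. The Gram matrices of
    its two operators are the matrices of the forms, so that of the square root is their matrix
    mean, which is unique. *)
Lemma congr_form_mean_unique g :
  is_form_mean (congr_form A) (congr_form B) g -> g = congr_form S.
Proof.
move=> [[H h A' B' hd A'p B'p A'B' AE BE] [S' [S'p SS' gE]]] /=.
rewrite /= in S' S'p SS' gE.
pose f := (h \o @choi_unvec C m n : {linear _ -> _}).
have fd : dense (range f).
  move=> O O0 Oo; have [z [Oz [u _ uz]]] := hd O O0 Oo.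
  by exists z; split=> //; exists (choi_vec u) => //=; rewrite choi_vecK.
have gramE M (M' : {linear H -> H}) :
    (forall x y, congr_form M x y = hdot (M' (h x)) (h y)) ->
    gram_mx f M' = T ^t* *m M *m T.
  move=> ME; apply: eq_quad => v; rewrite gram_mxE /= -ME /congr_form.
  by rewrite choi_unvecK.
have := gram_mx_mean fd A'p B'p S'p A'B' SS'.
rewrite (gramE A) // (gramE B) // => Smean.
have SE : gram_mx f S' = T ^t* *m S *m T.
  exact: is_psd_mean_uniq Smean (is_psd_mean_congr_comm Tu Ap Bp Sp AB SS).
apply/funext => u; apply/funext => v; rewrite gE /congr_form -SE gram_mxE /=.
by rewrite !choi_vecK.
Qed.

Lemma form_mean_congr :
  form_mean (congr_form A) (congr_form B) = congr_form S.
Proof.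
by apply: xget_unique; [apply: congr_form_mean|apply: congr_form_mean_unique].
Qed.

End FormMean.

Lemma form_mean_cp_form m n (Phi Psi Theta : {linear 'M[C]_m -> 'M[C]_n}) : (0 < n)%N ->
  completely_positive Phi -> completely_positive Psi ->
  is_psd_mean (choi Phi) (choi Psi) (choi Theta) ->
  form_mean (cp_form Phi) (cp_form Psi) = cp_form Theta.
Proof.
move=> n0 Phip Psip meanE.
have [T [A [B [Tu Ap Bp AB [PhiE PsiE]]]]] :=
  psd_simdiag (choi_psd Phip) (choi_psd Psip).
have [S Sp SS] := psd_sqrt (psd_mul_comm Ap Bp AB).
have ThetaE : choi Theta = T ^t* *m S *m T.
  have := is_psd_mean_congr_comm Tu Ap Bp Sp AB SS; rewrite -PhiE -PsiE.
  exact: is_psd_mean_uniq.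
pose t : C := n%:R^-1.
have t0 : 0 < t by rewrite invr_gt0 ltr0n.
(* A map with Choi matrix T^* M T has a form with matrix (1/n) (T^* M T) (x) 1 = U^* (M (x) 1) U. *)
pose U : 'M[C]_((m * n) * (m * n)) := sqrtC t *: (T *t 1%:M).
have Uu : U \in unitmx by rewrite unitmxZ ?unitfE ?sqrtC_eq0 ?gt_eqF // tens1_unit.
have formE (Xi : {linear 'M[C]_m -> 'M[C]_n}) M : choi Xi = T ^t* *m M *m T ->
    cp_form Xi = congr_form U (M *t 1%:M).
  move=> XiE; apply/funext => u; apply/funext => v.
  by rewrite cp_form_choi XiE /congr_form tens1_congr ger0_norm // ltW.
rewrite (formE Phi A) // (formE Psi B) // (formE Theta S) //.
apply: form_mean_congr => //; try exact: psd_tens1.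
  by rewrite !tensmx_mul AB.
by rewrite !tensmx_mul SS.
Qed.

Lemma L2dot_inj n (X Y : 'M[C]_n) : (0 < n)%N ->
  (forall xi eta, L2dot (X *m xi) eta = L2dot (Y *m xi) eta) -> X = Y.
Proof.
move=> n0 XY; apply/matrixP => a b.
(* Testing at xi = 1 and eta = e_ab reads off one entry, up to the nonzero factor 1/n. *)
have tE (Z : 'M[C]_n) :
    L2dot (Z *m 1%:M) (delta_mx a b) = n%:R^-1 * Z a b.
  rewrite /L2dot mulmx1 trmx_delta map_delta_mx; congr (_ * _).
  rewrite -(mul_delta_mx (0 : 'I_1)) -mulmxA mxtrace_mulC -mulmxA -colE -rowE.
  by rewrite trace_mx11 !mxE.
have := XY 1%:M (delta_mx a b); rewrite !tE; apply: mulfI.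
by rewrite invr_eq0 pnatr_eq0 -lt0n.
Qed.

End Choi.

Theorem proposition4p1 (R : realType) (m n : nat)
    (hm : (0 < m)%N) (hn : (0 < n)%N)
    (Phi Psi : {linear 'M[R[i]]_m -> 'M[R[i]]_n})
    (hPhi : completely_positive Phi) (hPsi : completely_positive Psi) :
  choi (cp_mean Phi Psi) = psdmx_mean (choi Phi) (choi Psi).
Proof.
have [T [A [B [Tu Ap Bp AB [PhiE PsiE]]]]] :=
  psd_simdiag (choi_psd hPhi) (choi_psd hPsi).
have [S Sp SS] := psd_sqrt (psd_mul_comm Ap Bp AB).
(* A root of S is taken so that the rows of Q T give Kraus operators with Choi matrix (Q T)^* (Q T)
   = T^* S T. *)
have [Q /psd_herm Qh QQ] := psd_sqrt Sp.
pose Theta := kraus (fun r => \matrix_(i, a) (Q *m T) r (mxtens_index (i, a))).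
have ThetaE : choi Theta = T ^t* *m S *m T.
  by rewrite choi_kraus adjmxM Qh -QQ !mulmxA.
have meanE : is_psd_mean (choi Phi) (choi Psi) (choi Theta).
  rewrite ThetaE PhiE PsiE.
  exact: is_psd_mean_congr_comm Tu Ap Bp Sp AB SS.
rewrite (psdmx_mean_unique meanE).
have formE := form_mean_cp_form hn hPhi hPsi meanE.
have ThetaP : is_cp_mean Phi Psi Theta.
  split; [exact: kraus_linear|exact: kraus_cp|move=> x y xi eta].
  by rewrite formE cp_formE.
(* The defining identity at y = 1 determines the map at every x, so [Theta] is the only
   candidate. *)
congr choi; apply: xget_unique => [|Xi [_ _ XiE]]; first exact: ThetaP.
apply/funext => x; apply: (L2dot_inj hn) => xi eta.
have [_ _ TE] := ThetaP.
by have := XiE x 1%:M xi eta; rewrite -TE adjmx1 mul1mx.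
Qed.
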